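(* Let $\mathcal{F}:\mathcal{P}_+\to\mathbb{R}$ be a finite functional (with $L^2$ first variation $\frac{\delta\mathcal{F}}{\delta\rho}$). Then the gradient flow of $\mathcal{F}(\rho)$ in $(\mathcal{P}_+,g_{\rho,\mathcal{C}})$, where $g_{\rho,\mathcal{C}}$ is the Kalman-Wasserstein metric tensor, satisfies $$\partial_t\rho=\nabla\cdot\Bigl(\rho\,\mathcal{C}(\rho)\nabla\frac{\delta\mathcal{F}}{\delta\rho}\Bigr).$$
   Context: Let $\Omega\subseteq\mathbb{R}^d$ be convex, let $$\mathcal{P}=\Bigl\{\rho\in L^1(\Omega):\rho\ge0\text{ a.e.},\ \int_\Omega\rho\,dx=1\Bigr\},\qquad \mathcal{P}_+=\{\rho\in\mathcal{P}:\rho>0\text{ a.e.},\ \rho\in C^\infty(\Omega)\}.$$ The mean and covariance of $\rho$ (assumed to exist) are $m(\rho)=\int_\Omega v\,\rho(v)\,dv$ and $\mathcal{C}(\rho)=\int_\Omega(v-m(\rho))\otimes(v-m(\rho))\rho(v)\,dv$. The tangent space of $\mathcal{P}_+$ at $\rho$ is $T_\rho\mathcal{P}_+=\{\sigma\in C^\infty(\Omega):\int_\Omega\sigma\,dx=0\}$. Cotangent vectors $\phi\in T_\rho^*\mathcal{P}_+$ are identified with tangent vectors through the Onsager operator $$V_{\rho,\mathcal{C}}:T_\rho^*\mathcal{P}_+\to T_\rho\mathcal{P}_+,\qquad V_{\rho,\mathcal{C}}(\phi)=-\nabla\cdot(\rho\,\mathcal{C}(\rho)\nabla\phi)=:(-\Delta_{\rho,\mathcal{C}})\phi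 .$$ For $\rho\in\mathcal{P}_+$ bounded away from zero this operator is taken to be invertible, giving a one-to-one correspondence $\sigma\mapsto\phi=(-\Delta_{\rho,\mathcal{C}})^{-1}\sigma$ (for general $\rho\in\mathcal{P}_+$ the pseudo-inverse is used). Integrations by parts involving $\Delta_{\rho,\mathcal{C}}$ are understood to produce no boundary terms. Kalman-Wasserstein metric tensor: $g_{\rho,\mathcal{C}}:T_\rho\mathcal{P}_+\times T_\rho\mathcal{P}_+\to\mathbb{R}$, $$g_{\rho,\mathcal{C}}(\sigma_1,\sigma_2)=\int_\Omega\langle\nabla\phi_1,\mathcal{C}(\rho)\nabla\phi_2\rangle\,\rho\,dx,\qquad \sigma_i=(-\Delta_{\rho,\mathcal{C}})\phi_i=-\nabla\cdot(\rho\,\mathcal{C}(\rho)\nabla\phi_i),\ i=1,2.$$ The $L^2$ first variation $\frac{\delta\mathcal{F}}{\delta\rho}$ at $\rho$ is the function representing the differential of $\mathcal{F}$: $\frac{d}{d\epsilon}\mathcal{F}(\rho+\epsilon\sigma)|_{\epsilon=0}=\int_\Omega\frac{\delta\mathcal{F}}{\delta\rho}\,\sigma\,du$ for $\sigma\in T_\rho\mathcal{P}_+$. The Riemannian gradient $\mathrm{grad}\,\mathcal{F}(\rho)\in T_\rho\mathcal{P}_+$ is defined by $$g_{\rho,\mathcal{C}}(\sigma,\mathrm{grad}\,\mathcal{F}(\rho))=\int_\Omega\frac{\delta\mathcal{F}}{\delta\rho}(u)\,\sigma(u)\,du\qquad\forall\sigma\in T_\rho\mathcal{P}_+,$$ and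 the gradient flow of $\mathcal{F}$ is the equation $\partial_t\rho=-\mathrm{grad}\,\mathcal{F}(\rho)$. *)

(* Defs.v *)
From HB Require Import structures.
From mathcomp Require Import all_boot all_order all_algebra.
From mathcomp Require Import all_classical all_reals all_analysis.

Set Implicit Arguments.
Unset Strict Implicit.
Unset Printing Implicit Defensive.

Import Order.TTheory GRing.Theory Num.Theory.
Import numFieldNormedType.Exports.

Local Open Scope classical_set_scope.
Local Open Scope ring_scope.

Definition measure_rV_display : measure_display -> measure_display.
Proof. exact. Qed.

(* The Borel sigma-algebra of R^n, as the product sigma-algebra. *)
Section measurable_rV.
Variables (R : realType) (n : nat).

Definition rV_coord (i : 'I_n) (x : 'rV[R]_n) : measurableTypeR R := x 0 i.

Let rV_set0 : g_sigma_preimage rV_coord set0.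
Proof. exact: sigma_algebra0. Qed.

Let rV_setC A : g_sigma_preimage rV_coord A -> g_sigma_preimage rV_coord (~` A).
Proof. exact: sigma_algebraC. Qed.

Let rV_bigcup (F : (set 'rV[R]_n)^nat) :
  (forall i, g_sigma_preimage rV_coord (F i)) ->
  g_sigma_preimage rV_coord (\bigcup_i (F i)).
Proof. exact: sigma_algebra_bigcup. Qed.

HB.instance Definition _ :=
  @isMeasurable.Build (measure_rV_display default_measure_display)
    'rV[R]_n (g_sigma_preimage rV_coord) rV_set0 rV_setC rV_bigcup.

End measurable_rV.

Section cons_rV.
Variable R : realType.

Definition cons_rV n (p : measurableTypeR R * 'rV[R]_n) : 'rV[R]_n.+1 :=
  \row_i oapp (fun j => p.2 0 j) p.1 (unlift ord0 i).

Definition uncons_rV n (x : 'rV[R]_n.+1) : measurableTypeR R * 'rV[R]_n :=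
  (x 0 ord0, \row_j x 0 (lift ord0 j)).

Lemma uncons_rVK n : cancel (@uncons_rV n) (@cons_rV n).
Proof.
move=> x; apply/rowP => i; rewrite mxE /=.
by case: unliftP => [j ->|->] //=; rewrite mxE.
Qed.

Lemma cons_rVK n : cancel (@cons_rV n) (@uncons_rV n).
Proof.
move=> [a y]; rewrite /uncons_rV mxE unlift_none; congr pair.
by apply/rowP => j; rewrite !mxE liftK.
Qed.

Lemma measurable_rV_coord n (i : 'I_n) :
  measurable_fun [set: 'rV[R]_n] (@rV_coord R n i).
Proof.
move=> _ Y mY; rewrite setTI; apply: sub_sigma_algebra => /=.
rewrite -bigcup_seq/=; exists i => /=; first by rewrite mem_index_enum.
by exists Y => //; rewrite setTI.
Qed.

Lemma measurable_fun_rVP d (T : measurableType d) n (f : T -> 'rV[R]_n) :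
  (forall i, measurable_fun [set: T] (@rV_coord R n i \o f)) ->
  measurable_fun [set: T] f.
Proof.
move=> mf.
suff : g_sigma_preimage (fun i => @rV_coord R n i \o f) `<=` measurable.
  by rewrite g_sigma_preimage_comp => sub _ A mA; apply: sub; exists A.
apply: smallest_sub; first exact: sigma_algebra_measurable.
case: n => [|n] in f mf *; first by rewrite big_ord0.
rewrite -bigcup_mkord_ord; apply: bigcup_sub => i Ii.
by move=> A [B mB <-]; exact: mf.
Qed.

Lemma measurable_cons_rV n : measurable_fun setT (@cons_rV n).
Proof.
apply: measurable_fun_rVP => i; case: (unliftP ord0 i) => [j ->|->].
- rewrite (_ : _ \o _ = @rV_coord R n j \o snd); last first.
    by apply/funext => p /=; rewrite /rV_coord mxE liftK.
  exact: measurableT_comp (measurable_rV_coord _) measurable_snd.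
- rewrite (_ : _ \o _ = fst); first exact: measurable_fst.
  by apply/funext => p /=; rewrite /rV_coord mxE unlift_none.
Qed.

Lemma measurable_uncons_rV n : measurable_fun setT (@uncons_rV n).
Proof.
apply: measurable_fun_pair; first exact: measurable_rV_coord.
apply: measurable_fun_rVP => j.
rewrite (_ : _ \o _ = @rV_coord R n.+1 (lift ord0 j)).
  exact: measurable_rV_coord.
by apply/funext => x /=; rewrite /rV_coord mxE.
Qed.

Section lebesgue_rV_step.
Variables (n : nat) (mu : {sigma_finite_measure set 'rV[R]_n -> \bar R}).

Definition lebesgue_rV_step : set 'rV[R]_n.+1 -> \bar R :=
  pushforward (@lebesgue_measure R \x mu)%E (@cons_rV n).

Let mcons A : measurable A -> measurable (@cons_rV n @^-1` A).
Proof. by move=> mA; rewrite -[X in measurable X]setTI; exact: measurable_cons_rV. Qed.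

Let step0 : lebesgue_rV_step set0 = 0%E.
Proof. by rewrite /lebesgue_rV_step /pushforward preimage_set0 measure0. Qed.

Let step_ge0 A : (0 <= lebesgue_rV_step A)%E.
Proof. by rewrite /lebesgue_rV_step /pushforward measure_ge0. Qed.

Let step_sigma_additive : semi_sigma_additive lebesgue_rV_step.
Proof.
move=> A mA tA mUA; rewrite /lebesgue_rV_step /pushforward preimage_bigcup.
apply: measure_semi_sigma_additive => [i||].
- exact: mcons.
- apply/trivIsetP => i j _ _ ij; rewrite -preimage_setI.
  by move/trivIsetP : tA => /(_ _ _ _ _ ij) ->//; rewrite preimage_set0.
- by rewrite -preimage_bigcup; exact: mcons.
Qed.

HB.instance Definition _ := isMeasure.Build _ _ _
  lebesgue_rV_step step0 step_ge0 step_sigma_additive.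

Let step_sigma_finite : sigma_finite setT lebesgue_rV_step.
Proof.
have /sigma_finiteP[A [AT ndA Afin]] := sigma_finiteT (@lebesgue_measure R).
have /sigma_finiteP[B [BT ndB Bfin]] := sigma_finiteT mu.
exists (fun k => @uncons_rV n @^-1` (A k `*` B k)).
  rewrite -preimage_bigcup (_ : \bigcup_k _ = setT) ?preimage_setT//.
  apply/seteqP; split=> // -[x y] _.
  have [[i _ Ax] [j _ By]] : (\bigcup_k A k) x /\ (\bigcup_k B k) y.
    by rewrite -AT -BT.
  exists (maxn i j) => //; split.
  - by move: x Ax; exact/subsetPset/ndA/leq_maxl.
  - by move: y By; exact/subsetPset/ndB/leq_maxr.
move=> k; have [mA Aoo] := Afin k; have [mB Boo] := Bfin k.
have mAB : measurable (A k `*` B k) by exact: measurableX.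
split; first by rewrite -[X in measurable X]setTI; exact: measurable_uncons_rV.
rewrite /lebesgue_rV_step /pushforward -comp_preimage.
rewrite (_ : _ \o _ = id) ?preimage_id; last first.
  by apply/funext => p; exact: cons_rVK.
by rewrite product_measure1E// lte_mul_pinfty// ge0_fin_numE.
Qed.

HB.instance Definition _ := Measure_isSigmaFinite.Build _ _ _
  lebesgue_rV_step step_sigma_finite.

End lebesgue_rV_step.

(* The n-dimensional Lebesgue measure, as an iterated product measure;
   [lebesgue_rV_box] below characterizes it. *)
Fixpoint lebesgue_rV n : {sigma_finite_measure set 'rV[R]_n -> \bar R} :=
  match n with
  | 0 => \d_(0 : 'rV[R]_0)
  | n'.+1 => lebesgue_rV_step (lebesgue_rV n')
  end.

Lemma lebesgue_rV_box n (A : 'I_n -> set (measurableTypeR R)) :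
  (forall i, measurable (A i)) ->
  lebesgue_rV n [set x : 'rV[R]_n | forall i, A i (x 0 i)] =
  (\prod_i lebesgue_measure (A i))%E.
Proof.
elim: n A => [|n IHn] A mA /=.
  by rewrite big_ord0 diracE mem_set//= => -[].
rewrite big_ord_recl -IHn// /lebesgue_rV_step /pushforward.
set B := [set y : 'rV[R]_n | _].
have mB : measurable B.
  rewrite (_ : B = \bigcap_(i : 'I_n) (@rV_coord R n i @^-1` A (lift ord0 i))).
    apply: fin_bigcap_measurable => [|i _]; first exact: finite_finset.
    by rewrite -[X in measurable X]setTI; exact: measurable_rV_coord.
  by apply/seteqP; split => y /= By i => [_|]; exact: By.
rewrite -product_measure1E//; congr (_ _).
apply/seteqP; split => [[a y] /= Aay|[a y] /= [Aa By] i].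
  split; first by have := Aay ord0; rewrite mxE unlift_none.
  by move=> j /=; have := Aay (lift ord0 j); rewrite mxE liftK.
by rewrite mxE; case: unliftP => [j ->|->] //=; exact: By.
Qed.

End cons_rV.

Section calculus.
Variables (R : realType) (d : nat).
Implicit Types (f : 'rV[R]_d -> R) (Omega : set 'rV[R]_d).

Definition partial (i : 'I_d) f : 'rV[R]_d -> R := 'D_(delta_mx 0 i) f.

Definition iter_partial (s : seq 'I_d) f := foldr partial f s.

(* [Omega] need not be open: being smooth on [Omega] means being smooth on an
   open neighbourhood of [Omega]. *)
Definition smooth_on Omega f :=
  exists2 U : set 'rV[R]_d, open U & Omega `<=` U /\
    forall s x, U x -> differentiable (iter_partial s f) x.

Definition grad f (x : 'rV[R]_d) : 'cV[R]_d := \col_i partial i f x.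

Definition divergence (X : 'rV[R]_d -> 'cV[R]_d) (x : 'rV[R]_d) : R :=
  \sum_i partial i (fun y => X y i 0) x.

Definition dot (u v : 'cV[R]_d) : R := \sum_i u i 0 * v i 0.

End calculus.

Section kalman_wasserstein.
Variables (R : realType) (d : nat) (Omega : set 'rV[R]_d).
Implicit Types rho sigma phi theta psi G : 'rV[R]_d -> R.

Local Notation mu := (lebesgue_rV R d).

Definition density rho :=
  [/\ mu.-integrable Omega (EFin \o rho),
      {ae mu, forall x, Omega x -> 0 <= rho x} &
      \int[mu]_(x in Omega) rho x = 1].

Definition smooth_density rho :=
  [/\ density rho, {ae mu, forall x, Omega x -> 0 < rho x} &
      smooth_on Omega rho].

Definition mean_rV rho : 'rV[R]_d := \row_i \int[mu]_(v in Omega) (v 0 i * rho v).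

Definition covariance_mx rho : 'M[R]_d :=
  \matrix_(i, j) \int[mu]_(v in Omega)
    ((v 0 i - mean_rV rho 0 i) * (v 0 j - mean_rV rho 0 j) * rho v).

Definition has_mean_covariance rho :=
  (forall i, mu.-integrable Omega (fun v => (v 0 i * rho v)%:E)) /\
  (forall i j, mu.-integrable Omega (fun v =>
     ((v 0 i - mean_rV rho 0 i) * (v 0 j - mean_rV rho 0 j) * rho v)%:E)).

Definition tangent sigma :=
  [/\ smooth_on Omega sigma, mu.-integrable Omega (EFin \o sigma) &
      \int[mu]_(x in Omega) sigma x = 0].

Definition onsager rho phi : 'rV[R]_d -> R := fun x =>
  - divergence (fun y => rho y *: (covariance_mx rho *m grad phi y)) x.

Definition kw_form rho phi1 phi2 : 'rV[R]_d -> R := fun x =>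
  dot (grad phi1 x) (covariance_mx rho *m grad phi2 x) * rho x.

(* The last clause is the convention that integrations by parts against the
   Onsager operator produce no boundary terms (a weak no-flux condition on
   [phi]); on a domain with boundary not every smooth [phi] satisfies it.  The
   test functions [theta] are those for which both sides converge because of
   the other clauses. *)
Definition cotangent rho phi :=
  [/\ smooth_on Omega phi,
      mu.-integrable Omega (EFin \o kw_form rho phi phi),
      tangent (onsager rho phi) &
      forall theta, smooth_on Omega theta ->
        (exists M : R, forall x, Omega x -> `|theta x| <= M) ->
        mu.-integrable Omega (EFin \o kw_form rho theta theta) ->
        \int[mu]_(x in Omega) (theta x * onsager rho phi x) =
        \int[mu]_(x in Omega) kw_form rho theta phi x].

Definition potential rho sigma phi :=
  cotangent rho phi /\ forall x, Omega x -> onsager rho phi x = sigma x.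

(* [kw_metric rho sigma1 sigma2 a] reads "the metric tensor at [rho] takes the
   value [a] on [(sigma1, sigma2)]".  It is a relation because it is defined
   only on the tangent vectors in the range of the Onsager operator, which is
   the whole tangent space when that operator is invertible. *)
Definition kw_metric rho sigma1 sigma2 (a : R) :=
  exists phi1 phi2, [/\ potential rho sigma1 phi1, potential rho sigma2 phi2 &
    a = \int[mu]_(x in Omega) kw_form rho phi1 phi2 x].

(* [F] is only evaluated at elements of the smooth densities, whence the
   restriction to directions [sigma] along which [rho] can be perturbed. *)
Definition first_variation (F : ('rV[R]_d -> R) -> R) rho psi :=
  smooth_on Omega psi /\
  forall sigma, tangent sigma ->
    (\forall e \near (0 : R), smooth_density (fun x => rho x + e * sigma x)) ->
    mu.-integrable Omega (fun x => (psi x * sigma x)%:E) /\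
    is_derive (0 : R) (1 : R) (fun e : R => F (fun x => rho x + e * sigma x))
      (\int[mu]_(x in Omega) (psi x * sigma x)).

(* [G] is the Riemannian gradient at [rho] of a functional whose first
   variation at [rho] is [psi].  The first clause says that the metric tensor is
   defined at [G]. *)
Definition kw_gradient rho psi G :=
  [/\ exists phi, potential rho G phi,
      tangent G &
      forall sigma a, tangent sigma ->
        mu.-integrable Omega (fun x => (psi x * sigma x)%:E) ->
        kw_metric rho sigma G a ->
        a = \int[mu]_(x in Omega) (psi x * sigma x)].

Definition kw_gradient_flow (J : set R)
    (dF : ('rV[R]_d -> R) -> 'rV[R]_d -> R) (rho : R -> 'rV[R]_d -> R) :=
  forall t, J t -> smooth_density (rho t) /\
    exists2 G, kw_gradient (rho t) (dF (rho t)) G &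
      forall x, Omega x -> is_derive t (1 : R) (rho ^~ x) (- G x).

End kalman_wasserstein.

(* Main.v *)
Require Import Defs.
From mathcomp Require Import all_boot all_order all_algebra.
From mathcomp Require Import all_classical all_reals all_analysis.
From mathcomp Require Import measurable_realfun.
From mathcomp Require Import ring lra.

Import Order.TTheory GRing.Theory Num.Theory.
Import numFieldNormedType.Exports.

Set Implicit Arguments.
Unset Strict Implicit.
Unset Printing Implicit Defensive.

Local Open Scope classical_set_scope.
Local Open Scope ring_scope.

(** The formula identifies the Riemannian gradient of a functional with first
    variation [psi] as [onsager rho psi]: the Onsager operator being minus a
    divergence, the flow equation is then the claim. Formally, for every
    cotangent vector [theta] the gradient [G] satisfies
      [int theta G = g (onsager theta, G) = int psi (onsager theta)
                   = int theta (onsager psi)],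
    the outer equalities being integrations by parts. Nothing guarantees that
    [psi] itself satisfies the no-flux condition, so [theta] is restricted to
    smooth functions supported in a box contained in [Omega]. For these the
    integrations by parts hold without any boundary condition on the other
    function ([green]), and they are genuine cotangent vectors
    ([test_cotangent]).

    Green's identity rests on the vanishing of the integral of a partial
    derivative of a compactly supported function ([integral_partial0]),
    obtained from Fubini's theorem and the fundamental theorem of calculus in
    one variable. Products of the flat functions [exp (-1/x)] in each
    coordinate give enough test functions to conclude that [G = onsager psi] at
    the interior points of [Omega] ([vanish_on_box]).

    Finally, convexity carries the equality to every point of [Omega]. A convex
    set that contains no box lies in a hyperplane and hence carries no density
    of mass one ([convex_box]); and if it contains a box its interior is dense
    in it ([convex_interior_dense]), so that continuity of [G] and of
    [onsager psi] near [Omega] applies. A convex set may fail to be Borel,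
    but every integrand that has to be computed with vanishes outside a box of
    [Omega], and its integral over [Omega] is an integral over the whole space
    ([integral_supported]). *)

(** * Smooth functions *)

(** The difference of two functions that agree near a point is locally zero,
    hence differentiable there with zero differential. *)
Lemma near_eq_differentiable (R : numFieldType) (V W : normedModType R)
    (f g : V -> W) (x : V) : (\forall y \near x, f y = g y) ->
  differentiable f x -> differentiable g x.
Proof.
move=> fg df; pose k := g - f; have -> : g = f + k by rewrite /k addrC subrK.
apply: (differentiableD df).
have kE : k \o shift x = cst (k x) + (\0 : {linear V -> W}) +o_ 0 id.
  apply/eqaddoP => e e0.
  have kx : k x = 0 by rewrite /k !fctE (nbhs_singleton fg) subrr.
  have nk : \forall h \near 0, k (h + x) = 0.
    move: fg; rewrite (near_shift 0 x)/= subr0.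
    by apply: filterS => h /= fgh; rewrite /k !fctE fgh subrr.
  near=> h.
  rewrite /= !fctE /= kx add0r (near nk h) // subr0 normr0.
  by rewrite mulr_ge0 // ltW.
have c0 : continuous (\0 : {linear V -> W}) by exact: cst_continuous.
by apply/diff_locallyP; rewrite (diff_unique c0 kE).
Unshelve. all: by end_near.
Qed.

Definition smooth (R : realType) (d : nat) (U : set 'rV[R]_d)
    (f : 'rV[R]_d -> R) :=
  forall s x, U x -> differentiable (iter_partial s f) x.

Section smooth.
Context (R : realType) (d : nat).
Implicit Types (U V : set 'rV[R]_d) (f g : 'rV[R]_d -> R).

Lemma smoothS U V f : V `<=` U -> smooth U f -> smooth V f.
Proof. by move=> VU sf s x /VU; exact: sf. Qed.

Lemma smoothU U V f : smooth U f -> smooth V f -> smooth (U `|` V) f.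
Proof. by move=> sU sV s x [/sU|/sV]; exact. Qed.

Lemma smooth_differentiable U f x : smooth U f -> U x -> differentiable f x.
Proof. by move=> sf; exact: (sf [::]). Qed.

Lemma smooth_partial U f i : smooth U f -> smooth U (partial i f).
Proof.
by move=> sf s x Ux; have := sf (rcons s i) x Ux;
  rewrite /iter_partial foldr_rcons.
Qed.

(** Iterated derivatives of a product have no simple closed form, whereas
    smoothness to a finite order passes to products by induction on the order,
    with one use of the Leibniz rule per order. *)
Fixpoint smooth_upto n U f := (forall x, U x -> differentiable f x) /\
  (if n is m.+1 then forall i, smooth_upto m U (partial i f) else True).

Lemma smooth_uptoP U f : smooth U f <-> forall n, smooth_upto n U f.
Proof.
split=> [sf n|sf].
  elim: n f sf => [|n IHn] f sf; split => //; try exact: (sf [::]).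
  by move=> i; apply: IHn; exact: smooth_partial.
move=> s; elim/last_ind: s f sf => [|s i IHs] f sf.
  by have [] := sf 0.
rewrite /iter_partial foldr_rcons; apply: IHs => n.
by have [_] := sf n.+1; exact.
Qed.

Lemma open_near_eq U f g x : open U -> (forall y, U y -> f y = g y) -> U x ->
  \forall y \near x, f y = g y.
Proof. by move=> oU fg Ux; apply: filterS (open_nbhs_nbhs (conj oU Ux)) => y;
  exact: fg. Qed.

Lemma partial_ext U f g i x : open U -> (forall y, U y -> f y = g y) -> U x ->
  partial i f x = partial i g x.
Proof. by move=> oU fg Ux; apply: near_eq_derive;
  exact: (open_near_eq oU fg Ux). Qed.

Lemma smooth_ext U f g : open U -> (forall y, U y -> f y = g y) ->
    smooth U f -> smooth U g.
Proof.
move=> oU fg sf s x Ux; apply: (near_eq_differentiable _ (sf s x Ux)).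
apply: (open_near_eq oU _ Ux); elim: s {x Ux} => [//|i s IHs] x Ux /=.
exact: (partial_ext i oU IHs Ux).
Qed.

Lemma partialD f g i x : differentiable f x -> differentiable g x ->
  partial i (f \+ g) x = partial i f x + partial i g x.
Proof. by move=> df dg; rewrite /partial deriveD//; exact: diff_derivable. Qed.

Lemma partialM f g i x : differentiable f x -> differentiable g x ->
  partial i (f \* g) x = f x * partial i g x + g x * partial i f x.
Proof. by move=> df dg; rewrite /partial deriveM//; exact: diff_derivable. Qed.

Lemma smooth_upto_ext n U f g : open U -> (forall y, U y -> f y = g y) ->
    smooth_upto n U f -> smooth_upto n U g.
Proof.
move=> oU; elim: n f g => [|n IHn] f g fg [df sf]; split.
- by move=> x Ux; apply: near_eq_differentiable (df x Ux);
  exact: (open_near_eq oU fg Ux).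
- by [].
- by move=> x Ux; apply: near_eq_differentiable (df x Ux);
  exact: (open_near_eq oU fg Ux).
- by move=> i; apply: (IHn _ _ _ (sf i)) => y; exact: partial_ext.
Qed.

Lemma smooth_uptoD n U f g : open U -> smooth_upto n U f ->
    smooth_upto n U g -> smooth_upto n U (f \+ g).
Proof.
move=> oU; elim: n f g => [|n IHn] f g [df sf] [dg sg]; split => //.
- by move=> x Ux; apply: differentiableD; [exact: df|exact: dg].
- by move=> x Ux; apply: differentiableD; [exact: df|exact: dg].
- move=> i; apply: (@smooth_upto_ext n U (partial i f \+ partial i g)) => //.
    by move=> y Uy; rewrite (partialD _ (df _ Uy) (dg _ Uy)).
  by apply: IHn; [exact: sf|exact: sg].
Qed.

Lemma smooth_uptoW n U f : smooth_upto n.+1 U f -> smooth_upto n U f.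
Proof.
elim: n f => [|n IHn] f [df sf]; split => // i.
by apply: IHn; exact: sf.
Qed.

Lemma smooth_uptoM n U f g : open U -> smooth_upto n U f ->
    smooth_upto n U g -> smooth_upto n U (f \* g).
Proof.
move=> oU; elim: n f g => [|n IHn] f g sf sg.
  by split => // x Ux; apply: differentiableM;
    [case: sf => + _|case: sg => + _]; exact.
have [df sdf] := sf; have [dg sdg] := sg; split.
  by move=> x Ux; apply: differentiableM; [exact: df|exact: dg].
move=> i; apply: (@smooth_upto_ext n U (f \* partial i g \+ g \* partial i f))
  => //.
  by move=> y Uy; rewrite (partialM _ (df _ Uy) (dg _ Uy)).
by apply: smooth_uptoD => //; apply: IHn;
  [exact: smooth_uptoW|exact: sdg|exact: smooth_uptoW|exact: sdf].
Qed.

Lemma smoothD U f g : open U -> smooth U f -> smooth U g -> smooth U (f \+ g).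
Proof. by move=> oU /smooth_uptoP sf /smooth_uptoP sg; apply/smooth_uptoP => n;
  exact: smooth_uptoD. Qed.

Lemma smoothM U f g : open U -> smooth U f -> smooth U g -> smooth U (f \* g).
Proof. by move=> oU /smooth_uptoP sf /smooth_uptoP sg; apply/smooth_uptoP => n;
  exact: smooth_uptoM. Qed.

Lemma smooth_cst U (c : R) : smooth U (cst c).
Proof.
apply/smooth_uptoP => n; elim: n c => [|n IHn] c; split => //;
  try by move=> x _; exact: differentiable_cst.
move=> i; rewrite (_ : partial i _ = cst 0) //.
by apply/funext => x; rewrite /partial derive_cst.
Qed.

Lemma smooth_sum U (I : finType) (F : I -> 'rV[R]_d -> R) : open U ->
  (forall i, smooth U (F i)) -> smooth U (fun x => \sum_i F i x).
Proof.
move=> oU sF; elim: (index_enum I) => [|i s IHs].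
  by under eq_fun do rewrite big_nil; exact: smooth_cst.
by under eq_fun do rewrite big_cons; exact: smoothD.
Qed.

Lemma smooth_prod U (I : finType) (F : I -> 'rV[R]_d -> R) : open U ->
  (forall i, smooth U (F i)) -> smooth U (fun x => \prod_i F i x).
Proof.
move=> oU sF; elim: (index_enum I) => [|i s IHs].
  by under eq_fun do rewrite big_nil; exact: smooth_cst.
by under eq_fun do rewrite big_cons; exact: smoothM.
Qed.

Lemma smoothN U f : open U -> smooth U f -> smooth U (fun x => - f x).
Proof.
move=> oU sf; under eq_fun do rewrite -mulN1r.
by apply: smoothM => //; exact: smooth_cst.
Qed.

Lemma smooth_continuous f : smooth setT f -> continuous f.
Proof. by move=> sf x; apply: differentiable_continuous;
  exact: (smooth_differentiable sf). Qed.

(** How functions known to be smooth only near [Omega] become globally smooth: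
    two smooth pieces, on [U] and on the complement of the support [K], cover
    the space. *)
Lemma smooth_extend0 U K f : open U -> closed K -> K `<=` U -> smooth U f ->
  (forall x, ~ K x -> f x = 0) -> smooth setT f.
Proof.
move=> oU cK KU sf f0.
have sV : smooth (~` K) f.
  by apply: (smooth_ext (f := cst 0)) (@smooth_cst _ _);
    [exact: closed_openC|move=> y /f0 ->].
apply: (smoothS (U := U `|` ~` K)); last exact: smoothU.
by move=> x _; have [/KU|] := pselect (K x); [left|right].
Qed.

End smooth.

(** * Smooth bumps supported in boxes *)

Section flat.
Context (R : realType).
Implicit Types (P : {poly R}) (x : R).

(** [flat 1] is the classical flat function [exp (-1/x)]; the polynomial factor
    in [1/x] makes the family stable under differentiation, with
    [flat_deriv] computing the derivative. *)
Definition flat P x := if 0 < x then P.[x^-1] * expR (- x^-1) else 0.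

Definition flat_deriv P : {poly R} := 'X^2 * (P - P^`()).

Lemma poly_expRN_bounded P :
  exists2 C, 0 <= C & forall z, 0 <= z -> `|P.[z]| * expR (- z) <= C.
Proof.
have monom k z : 0 <= z -> z ^+ k * expR (- z) <= k`!%:R.
  move=> z0; rewrite expRN ler_pdivrMr ?expR_gt0//.
  case: k => [|k].
    by rewrite expr0 fact0 mul1r -[leLHS]addr0 (le_trans _ (expR_ge1Dx z))//
      lerD2l.
  rewrite mulrC -ler_pdivrMr; last by rewrite ltr0n fact_gt0.
  by apply: le_trans (expR_ge1Dxn k z0); rewrite lerDr.
exists (\sum_(i < size P) `|P`_i| * i`!%:R).
  by apply: sumr_ge0 => i _; rewrite mulr_ge0.
move=> z z0; rewrite horner_coef.
apply: (le_trans (ler_wpM2r (expR_ge0 _) (ler_norm_sum _ _ _))).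
rewrite mulr_suml; apply: ler_sum => i _.
rewrite normrM -mulrA ler_wpM2l// (ger0_norm (exprn_ge0 _ z0)).
exact: monom.
Qed.

(** A quadratic bound at [0] makes the derivative at [0] exist and vanish.
    It comes from boundedness of [z^2 P(z) exp(-z)] at [z = 1/x]. *)
Lemma flat_quadratic P :
    exists2 C, 0 <= C & forall x, `|flat P x| <= C * x ^+ 2.
Proof.
have [C C0 PC] := poly_expRN_bounded ('X^2 * P); exists C => // x.
rewrite /flat; case: ltP => x0; last by rewrite normr0 mulr_ge0 // sqr_ge0.
have xi0 : 0 <= x^-1 by rewrite invr_ge0 ltW.
have := PC _ xi0; rewrite hornerM hornerXn normrM (ger0_norm (exprn_ge0 _ xi0)).
rewrite normrM (ger0_norm (expR_ge0 _)) exprVn -mulrA.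
by rewrite mulrC ler_pdivrMr // exprn_gt0.
Qed.

Lemma is_derive_flat P x : is_derive x 1 (flat P) (flat (flat_deriv P) x).
Proof.
have [x0|x0|->] := ltgtP x 0.
- have -> : flat (flat_deriv P) x = 0 by rewrite /flat ltNge (ltW x0).
  apply: (@near_eq_is_derive _ _ _ (cst 0)).
  by near=> y; rewrite /flat ltNge ltW //; near: y; exact: lt_nbhsl.
- have xn : x != 0 by rewrite gt_eqF.
  pose E z := P.[z] * expR (- z).
  apply: (@near_eq_is_derive _ _ _ (E \o (fun y : R => y^-1))).
    by near=> y; rewrite /flat ifT //; near: y; exact: lt_nbhsr.
  have dV : is_derive x 1 (fun y : R => y^-1) (- x ^- 2).
    by have := @is_deriveV R id x 1 1 xn (is_derive_id _ _);
      rewrite [_ *: _]mulr1.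
  have dE : is_derive x^-1 1 E
    (P^`().[x^-1] * expR (- x^-1) - P.[x^-1] * expR (- x^-1)).
    apply: is_derive_eq; rewrite /GRing.scale /=; ring.
  apply: (is_derive_eq (is_derive1_comp dE dV));
    rewrite /flat x0 /flat_deriv hornerM hornerXn hornerD hornerN.
  rewrite exprVn; ring.
- have -> : flat (flat_deriv P) 0 = 0 by rewrite /flat ltxx.
  have [C C0 PC] := flat_quadratic P.
  have cv : h^-1 *: (flat P (h *: 1 + 0) - flat P 0) @[h --> (0 : R)^'] -->
    (0 : R).
    have C10 : 0 < C + 1 by rewrite ltr_wpDl.
    apply/cvgr0Pnorm_lt => e e0; near=> h.
    have -> : flat P 0 = 0 by rewrite /flat ltxx.
    have hn : h != 0 by near: h; exact: nbhs_dnbhs_neq.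
    rewrite subr0 addr0 [h *: _]mulr1 normrZ normfV.
    rewrite mulrC ltr_pdivrMr ?normr_gt0 //.
    apply: (le_lt_trans (PC h)); rewrite -real_normK ?num_real // expr2 mulrA.
    rewrite ltr_pM2r ?normr_gt0 //.
    have : `|h| < e / (C + 1).
      near: h; apply: dnbhs0_lt; exact: divr_gt0.
    rewrite ltr_pdivlMr // mulrC => /le_lt_trans; apply.
    by rewrite ler_wpM2r // lerDl.
  apply: DeriveDef; first by apply/cvg_ex; exists 0.
  exact: cvg_lim.
Unshelve. all: by end_near.
Qed.

Lemma flat_gt0 x : 0 < x -> 0 < flat 1 x.
Proof. by move=> x0; rewrite /flat x0 hornerC mul1r expR_gt0. Qed.

Lemma flat_le0 P x : x <= 0 -> flat P x = 0.
Proof. by move=> x0; rewrite /flat ltNge x0. Qed.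

Lemma flat_ge0 x : 0 <= flat 1 x.
Proof. by have [x0|/flat_gt0/ltW//] := leP x 0; rewrite flat_le0. Qed.

End flat.

(** Reduces partial derivatives to derivatives of functions of one real
    variable. *)
Lemma derive_line (R : numFieldType) (V W : normedModType R) (f : V -> W)
    (x v : V) :
  'D_v f x = 'D_1 (fun h : R => f (h *: v + x)) 0.
Proof.
rewrite /derive; set g1 := fun h => h^-1 *: _; set g2 := fun h => h^-1 *: _.
suff -> : g1 = g2 by [].
by apply/funext => h; rewrite /g1 /g2 /= addr0 scale0r add0r [_%:A]mulr1.
Qed.

Section bump.
Context (R : realType) (d : nat).
Implicit Types (a x : 'rV[R]_d) (r : R) (f : 'rV[R]_d -> R).

Definition box a r : set 'rV[R]_d :=
    [set x : 'rV[R]_d | forall i, `|x 0 i - a 0 i| <= r].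

Definition cube a r : set 'rV[R]_d :=
    [set x : 'rV[R]_d | forall i, `|x 0 i - a 0 i| < r].

(** Closed boxes serve as the compact sets carrying the test functions: they
    form a basis of neighbourhoods and their Lebesgue measure is explicit. *)
Definition supported a r f := forall x, ~ box a r x -> f x = 0.

Lemma smooth_flat_coord (P : {poly R}) (c e : R) (i : 'I_d) :
  smooth setT (fun x : 'rV[R]_d => flat P (c + e * x 0 i)).
Proof.
have dC x : differentiable (fun x : 'rV[R]_d => c + e * x 0 i) x.
  apply: differentiableD; first exact: differentiable_cst.
  by apply: differentiableM;
    [exact: differentiable_cst|exact: differentiable_coord].
have dF Q x : differentiable (fun x : 'rV[R]_d => flat Q (c + e * x 0 i)) x.
  apply: (differentiable_comp (g := flat Q) (dC x)).
  by apply/derivable1_diffP; have [] := is_derive_flat Q (c + e * x 0 i).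
apply/smooth_uptoP => n; elim: n P => [|n IHn] P; split=> // j.
suff -> : partial j (fun x : 'rV[R]_d => flat P (c + e * x 0 i)) =
    (cst (e * (i == j)%:R)) \* (fun x => flat (flat_deriv P) (c + e * x 0 i)).
  by apply: smooth_uptoM;
    [exact: openT|exact: (iffLR (smooth_uptoP _ _) (smooth_cst _))|exact: IHn].
apply/funext => x; rewrite /partial derive_line /=.
have -> : (fun h : R => flat P (c + e * (h *: delta_mx 0 j + x) 0 i)) =
    flat P \o (fun h => (e * (i == j)%:R) * h + (c + e * x 0 i)).
  apply/funext => h /=; rewrite !mxE eqxx /=; congr flat; ring.
have dl : is_derive (0 : R) 1 (fun h => (e * (i == j)%:R) * h + (c + e * x 0 i))
    (e * (i == j)%:R).
  by apply: is_derive_eq; rewrite /GRing.scale /=; ring.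
have df := is_derive_flat P (e * (i == j)%:R * 0 + (c + e * x 0 i)).
pose l (h : R) : R := (e * (i == j)%:R) * h + (c + e * x 0 i).
have [_ ->] := @is_derive1_comp R (flat P) l 0 _ _ df dl.
by rewrite mulr0 add0r mulrC.
Qed.

Definition box_bump a r : 'rV[R]_d -> R := fun x =>
  \prod_(i < d) (flat 1 (r - a 0 i + x 0 i) * flat 1 (r + a 0 i - x 0 i)).

Lemma smooth_box_bump a r : smooth setT (box_bump a r).
Proof.
apply: smooth_prod; first exact: openT.
move=> i; apply: smoothM; first exact: openT.
  by have := @smooth_flat_coord 1 (r - a 0 i) 1 i;
    under eq_fun do rewrite mul1r.
by have := @smooth_flat_coord 1 (r + a 0 i) (- 1) i;
  under eq_fun do rewrite mulN1r.
Qed.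

Lemma box_bump_ge0 a r x : 0 <= box_bump a r x.
Proof. by apply: prodr_ge0 => i _; rewrite mulr_ge0 // flat_ge0. Qed.

Lemma box_bump_gt0 a r x : cube a r x -> 0 < box_bump a r x.
Proof.
move=> xa; apply: prodr_gt0 => i _; have := xa i;
  rewrite ltr_norml => /andP[? ?].
by apply: mulr_gt0; apply: flat_gt0; lra.
Qed.

Lemma supported_box_bump a r : supported a r (box_bump a r).
Proof.
move=> x /existsNP[i /negP]; rewrite -ltNge => xr;
  rewrite /box_bump (bigD1 i)//=.
move: xr; rewrite ltr_normr => /orP[] xr.
  by rewrite [X in (_ * X) * _]flat_le0 ?mulr0 ?mul0r//; lra.
by rewrite [X in (X * _) * _]flat_le0 ?mul0r//; lra.
Qed.

End bump.

(** * Boxes, measurability and integrability in R^n *)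

Section boxes.
Context (R : realType) (n : nat).
Implicit Types (r : R) (a x : 'rV[R]_n) (U : set 'rV[R]_n).

Lemma continuous_coord i : continuous (fun x : 'rV[R]_n => x 0 i : R).
Proof. by move=> x; apply: differentiable_continuous;
  exact: differentiable_coord. Qed.

Lemma nbhs_box U a : nbhs a U -> exists2 r, 0 < r & box a r `<=` U.
Proof.
move=> /nbhs_ballP[e /= e0 eU]; exists (e / 2); first by rewrite divr_gt0.
move=> x xa; apply: eU; split => // i j; rewrite !ord1 /ball /= distrC.
by apply: le_lt_trans (xa j) _; rewrite gtr_pMr // invf_lt1 // ltr1n.
Qed.

Lemma nbhs_cube a r : 0 < r -> nbhs a (cube a r).
Proof.
move=> r0; apply/nbhs_ballP; exists r => //= x [_ xa] i.
by have := xa 0 i; rewrite /ball /= distrC.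
Qed.

Lemma closed_box a r : closed (box a r).
Proof.
rewrite (_ : box a r =
  \bigcap_(i in setT) ((fun x => x 0 i) @^-1` [set y | `|y - a 0 i| <= r])).
  apply: closed_bigI => i _.
  apply: closed_comp => [x _|]; first exact: continuous_coord.
  apply: (closed_comp (f := fun y => `|y - a 0 i|)) (@closed_le _ r) => y _.
  by apply: cvg_norm; apply: cvgB; [exact: cvg_id|exact: cvg_cst].
by apply/seteqP; split => x /= h i; [move=> _; exact: h|exact: h].
Qed.

Lemma compact_box a r : compact (box a r).
Proof.
suff -> : box a r =
    [set v : 'rV[R]_n | forall i, v ord0 i \in `[a 0 i - r, a 0 i + r]].
  by apply: (@rV_compact _ _ (fun i => `[a 0 i - r, a 0 i + r]%classic)) => i;
    exact: segment_compact.
apply/seteqP; split => x /= xa i; have := xa i; rewrite ?ler_distl //.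
Qed.

Lemma measurable_box a r : measurable (box a r).
Proof.
rewrite (_ : box a r =
  \bigcap_(i in setT) (@rV_coord R n i @^-1` [set y | `|y - a 0 i| <= r]));
  last first.
  by apply/seteqP; split => x /= h i; [move=> _; exact: h|exact: h].
apply: fin_bigcap_measurable => [|i _]; first exact: finite_finset.
rewrite -[X in measurable X]setTI; apply: measurable_rV_coord => //.
rewrite (_ : [set y | _] = `[a 0 i - r, a 0 i + r]%classic) //.
by apply/seteqP; split => y /=; rewrite in_itv /= ler_distl.
Qed.

Lemma lebesgue_box a r : lebesgue_rV R n (box a r) =
    (\prod_(i < n) lebesgue_measure `[(a 0 i - r)%R, (a 0 i + r)%R]%classic)%E.
Proof.
rewrite -lebesgue_rV_box //; congr (lebesgue_rV _ _ _).
by apply/seteqP; split => x /= xa i; have := xa i;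
  rewrite /= in_itv /= ler_distl.
Qed.

Lemma lebesgue_box_lty a r : (lebesgue_rV R n (box a r) < +oo)%E.
Proof.
suff : lebesgue_rV R n (box a r) \is a fin_num by rewrite fin_numE => /andP[_];
  rewrite ltey.
rewrite lebesgue_box; elim/big_ind : _ => // [x y x0 y0|i _];
  first exact: fin_numM.
by rewrite lebesgue_measure_itv /=; case: ifP.
Qed.

Lemma measurable_cube a r : measurable (cube a r).
Proof.
rewrite (_ : cube a r =
  \bigcap_(i in setT) (@rV_coord R n i @^-1` [set y | `|y - a 0 i| < r]));
  last first.
  by apply/seteqP; split => x /= h i; [move=> _; exact: h|exact: h].
apply: fin_bigcap_measurable => [|i _]; first exact: finite_finset.
rewrite -[X in measurable X]setTI; apply: measurable_rV_coord => //.
rewrite (_ : [set y | _] = `]a 0 i - r, a 0 i + r[%classic) //.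
by apply/seteqP; split => y /=; rewrite in_itv /= ltr_distl.
Qed.

Lemma lebesgue_cube_gt0 a r : 0 < r -> (0 < lebesgue_rV R n (cube a r))%E.
Proof.
move=> r0; have -> : cube a r =
  [set x : 'rV[R]_n | forall i, `]a 0 i - r, a 0 i + r[%classic (x 0 i)].
  by apply/seteqP; split => x /= xa i; have := xa i;
    rewrite /= in_itv /= ltr_distl.
rewrite (@lebesgue_rV_box R n (fun i => `]a 0 i - r, a 0 i + r[%classic)) //.
elim/big_ind : _ => [|x y|i _]; [exact: lte01|exact: mule_gt0|].
have h : (a 0 i - r < a 0 i + r :> R) by rewrite ltrD2l gtrN.
by rewrite lebesgue_measure_itv /= lte_fin h -EFinB lte_fin subr_gt0.
Qed.

(** An open set is a countable union of boxes with rational centres and radii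
    of the form [1/(k+1)]; the pair is decoded from a natural number. *)
Lemma open_measurable_rV U : open U -> measurable U.
Proof.
move=> oU.
pose c (q : 'rV[rat]_n) : 'rV[R]_n := \row_i ratr (q 0 i).
pose F (m : nat) : set 'rV[R]_n := if unpickle m is Some (q, k) then
  (if `[< box (c q) k.+1%:R^-1 `<=` U >] then box (c q) k.+1%:R^-1 else set0)
    else set0.
rewrite (_ : U = \bigcup_m F m).
  apply: bigcupT_measurable => m; rewrite /F.
  case: unpickle => [[q k]|//]; case: ifP => // _; exact: measurable_box.
apply/seteqP; split => [x Ux|x [m _]]; last first.
  by rewrite /F; case: unpickle => [[q k]|//]; case: ifP => // /asboolP; exact.
have [r r0 rU] := nbhs_box (open_nbhs_nbhs (conj oU Ux)).
have [k kr] : exists k : nat, k.+1%:R^-1 < r / 2.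
  have r20 : 0 < r / 2 by rewrite divr_gt0.
  exists (Num.bound (r / 2)^-1); rewrite invf_plt ?posrE //.
  apply: lt_trans (archi_boundP _) _; first by rewrite invr_ge0 ltW.
  by rewrite ltr_nat.
have /choice[q qx] : forall i, exists q : rat, `|ratr q - x 0 i| < k.+1%:R^-1.
  move=> i; have [|q] :=
    @rat_in_itvoo R (x 0 i - k.+1%:R^-1) (x 0 i + k.+1%:R^-1).
    by rewrite ltrD2l gtrN.
  by rewrite in_itv /= -ltr_distl => ?; exists q.
exists (pickle (\row_i q i, k)) => //; rewrite /F pickleK ifT.
  by move=> i; rewrite /c !mxE distrC ltW.
apply/asboolP => y yq; apply: rU => i.
have := yq i; have := qx i; rewrite /c !mxE.
move=> qxi yqi; apply: (le_trans (ler_distD (ratr (q i)) _ _)).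
by rewrite (splitr r) lerD // ltW // (le_lt_trans _ kr) // ltW.
Qed.

Lemma continuous_measurable_rV (f : 'rV[R]_n -> R) : continuous f ->
    measurable_fun setT f.
Proof.
move=> cf; apply: (measurability _
  (measurable_realfun.RGenOpens.measurableE R)).
move=> _ [_ [u [v ->]] <-]; rewrite setTI; apply: open_measurable_rV.
by apply: open_comp => [x _|]; [exact: cf|exact: interval_open].
Qed.

Lemma bounded_compact_support a r (f : 'rV[R]_n -> R) : continuous f ->
  supported a r f -> exists M, forall x, `|f x| <= M.
Proof.
move=> cf f0; have /compact_bounded[M [Mr MB]] : compact (f @` box a r).
  by apply: continuous_compact;
    [exact: continuous_subspaceT|exact: compact_box].
exists (`|M| + 1) => x; have [bx|/f0 ->] := pselect (box a r x); last first.
  by rewrite normr0 addr_ge0.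
by apply: MB; [rewrite ltr_pwDr // ler_norm|exists x].
Qed.

Lemma integrable_compact_support a r (f : 'rV[R]_n -> R) : continuous f ->
  supported a r f ->
  (lebesgue_rV R n).-integrable setT (EFin \o f).
Proof.
move=> cf f0.
rewrite (_ : EFin \o f = (EFin \o f) \_ (box a r)); last first.
  apply/funext => x; rewrite patchE; case: ifPn => // /negP;
    rewrite in_setE => /f0 /= ->.
  by [].
apply: (iffLR (integrable_mkcond _ (measurable_box a r))).
apply: measurable_bounded_integrable.
- exact: measurable_box.
- exact: lebesgue_box_lty.
- apply: measurable_funTS; exact: continuous_measurable_rV.
- have [M fM] := bounded_compact_support cf f0.
  by exists M; split; [exact: num_real|move=> N MN x _;
    exact: le_trans (fM x) (ltW MN)].
Qed.

End boxes.

(** * The integral of a compactly supported partial derivative *)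

Lemma continuous_rV (R : realType) n (T : topologicalType) (f : T -> 'rV[R]_n) :
  (forall i, continuous (fun t => f t 0 i)) -> continuous f.
Proof.
move=> cf x U /nbhs_box[r r0 rU].
have : \forall t \near x, forall i : 'I_n, `|f t 0 i - f x 0 i| <= r.
  apply: filter_forall => i; have /cvgrPdist_le := cf i x; move=> /(_ r r0).
  by apply: filterS => t; rewrite distrC.
by apply: filterS => t tr; apply: rU.
Qed.

Section slices.
Context (R : realType) (n : nat).
Implicit Types (b h : R) (y : 'rV[R]_n).

Lemma continuous_cons_head y : continuous (fun b : R => cons_rV (b, y)).
Proof.
apply: continuous_rV => i; case: (unliftP ord0 i) => [j ->|->] b.
  under eq_fun do rewrite mxE liftK /=; exact: cvg_cst.
by under eq_fun do rewrite mxE unlift_none /=; exact: cvg_id.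
Qed.

Lemma continuous_cons_tail b :
  continuous (fun y => cons_rV (b : measurableTypeR R, y)).
Proof.
apply: continuous_rV => i; case: (unliftP ord0 i) => [j ->|->].
  rewrite (_ : (fun _ => _) = fun y : 'rV[R]_n => y 0 j);
    first exact: continuous_coord.
  by apply/funext => y; rewrite mxE liftK.
rewrite (_ : (fun _ => _) = cst b); first exact: cst_continuous.
by apply/funext => y; rewrite mxE unlift_none.
Qed.

Lemma cons_line_head b h y : cons_rV (h + b : measurableTypeR R, y) =
    h *: delta_mx 0 ord0 + cons_rV (b : measurableTypeR R, y).
Proof.
apply/rowP => i; rewrite !mxE eqxx /=; case: unliftP => [j ->|->] /=.
  by rewrite mulr0 add0r.
by rewrite mulr1.
Qed.

Lemma cons_line_tail b h (j : 'I_n) y :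
  cons_rV (b : measurableTypeR R, h *: delta_mx 0 j + y) =
  h *: delta_mx 0 (lift ord0 j) + cons_rV (b : measurableTypeR R, y).
Proof.
apply/rowP => i; rewrite !mxE eqxx /=; case: unliftP => [k ->|->] /=.
  by rewrite !mxE eqxx /= (inj_eq lift_inj).
by rewrite mulr0 add0r.
Qed.

Local Open Scope ereal_scope.

Lemma integrable_cons (f : 'rV[R]_n.+1 -> \bar R) :
  (lebesgue_rV R n.+1).-integrable setT f ->
  (@lebesgue_measure R \x lebesgue_rV R n).-integrable setT (f \o @cons_rV R n).
Proof.
move=> /integrableP[mf foo]; apply/integrableP; split.
  move=> mE B mB; rewrite setTI comp_preimage -[X in measurable X]setTI.
  apply: (@measurable_cons_rV R n) => //; by rewrite -[X in measurable X]setTI;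
    exact: mf.
move: foo; rewrite [X in X < _ -> _](ge0_integral_pushforward
  (@measurable_cons_rV R n)) //.
  by apply: measurableT_comp.
Qed.

Lemma integral_cons (f : 'rV[R]_n.+1 -> \bar R) :
  (lebesgue_rV R n.+1).-integrable setT f ->
  \int[lebesgue_rV R n.+1]_x f x =
  \int[(@lebesgue_measure R \x lebesgue_rV R n)]_p f (cons_rV p).
Proof.
move=> fi; have mf := measurable_int _ fi.
by rewrite [LHS](integral_pushforward (@measurable_cons_rV R n)) //
  preimage_setT; exact: integrable_cons.
Qed.

Lemma integral_head_tail (f : 'rV[R]_n.+1 -> \bar R) :
  (lebesgue_rV R n.+1).-integrable setT f ->
  \int[lebesgue_rV R n.+1]_x f x =
  \int[@lebesgue_measure R]_b \int[lebesgue_rV R n]_y f (cons_rV (b, y)).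
Proof.
move=> fi; rewrite integral_cons //.
by rewrite -(integral12_prod_meas1 (integrable_cons fi)).
Qed.

Lemma integral_tail_head (f : 'rV[R]_n.+1 -> \bar R) :
  (lebesgue_rV R n.+1).-integrable setT f ->
  \int[lebesgue_rV R n.+1]_x f x =
  \int[lebesgue_rV R n]_y \int[@lebesgue_measure R]_b f (cons_rV (b, y)).
Proof.
move=> fi; rewrite integral_cons //.
by rewrite -(integral21_prod_meas1 (integrable_cons fi)).
Qed.

End slices.

Lemma integral_derivative0 (R : realType) (g h : R -> R) (a r : R) :
  (forall x, is_derive x (1 : R) g (h x)) -> continuous h ->
  (forall x, r < `|x - a| -> g x = 0 /\ h x = 0) ->
  (\int[@lebesgue_measure R]_x (h x)%:E = 0)%E.
Proof.
move=> dg ch off.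
pose s := `|r| + 1.
have rs : r < s by rewrite (le_lt_trans (ler_norm r)) // ltrDl.
have s0 : 0 < s by rewrite ltr_wpDl.
pose D : set R := `[a - s, a + s]%classic.
have -> : (\int[@lebesgue_measure R]_x (h x)%:E =
  \int[@lebesgue_measure R]_(x in D) (h x)%:E)%E.
  rewrite [RHS]integral_mkcond; apply: eq_integral => x _; rewrite patchE.
  case: ifPn => // /negP; rewrite in_setE /D /= in_itv /= -ler_distl => /negP.
  by rewrite -ltNge => sx; have [_ ->] := off x (lt_trans rs sx).
have lt : a - s < a + s by rewrite ltrD2l gtrN.
have cg : continuous g.
  by move=> x; apply/differentiable_continuous/derivable1_diffP; have [] :=
    dg x.
rewrite (@continuous_FTC2 _ h g) //.
- have [-> _] : g (a + s) = 0 /\ h (a + s) = 0.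
    by apply: off; rewrite addrC addKr gtr0_norm.
  have [-> _] : g (a - s) = 0 /\ h (a - s) = 0.
    by apply: off; rewrite addrC addKr normrN gtr0_norm.
  by rewrite subee.
- exact: continuous_subspaceT.
- split => [x _|/=|/=]; first by have [] := dg x.
  + exact: cvg_at_right_filter (cg _).
  + exact: cvg_at_left_filter (cg _).
- by move=> x _; rewrite derive1E; have [_ ->] := dg x.
Qed.

Lemma is_derive_lineP (R : numFieldType) (V W : normedModType R) (f : V -> W)
    (x v : V) (df : W) :
  is_derive x v f df <->
    is_derive (0 : R) (1 : R) (fun h : R => f (h *: v + x)) df.
Proof.
split=> -[dx <-]; apply: DeriveDef.
- exact: (iffLR (derivable1P _ _ _) dx).
- exact: (esym (derive_line f x v)).
- exact: (iffRL (derivable1P _ _ _) dx).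
- exact: (derive_line f x v).
Qed.

(** Induction on the dimension: by Fubini's theorem, the integral is iterated
    with the [i]-th variable on the inside. For the head variable the inner
    integral vanishes by the fundamental theorem of calculus, and for a tail
    variable by the induction hypothesis on the slices. *)
Lemma integral_partial0 (R : realType) n (i : 'I_n) (g h : 'rV[R]_n -> R)
    (a : 'rV[R]_n) (r : R) :
  (forall x, is_derive x (delta_mx 0 i) g (h x)) -> continuous h ->
  supported a r g -> supported a r h ->
  (\int[lebesgue_rV R n]_x (h x)%:E = 0)%E.
Proof.
elim: n i g h a => [[]//|n IHn] i g h a dg ch g0 h0.
have hi : (lebesgue_rV R n.+1).-integrable setT (EFin \o h).
  exact: integrable_compact_support ch h0.
case: (unliftP ord0 i) dg => [j ->|->] dg.
- rewrite (integral_head_tail hi); apply: integral0_eq => b _.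
  have tail y : box a r (cons_rV (b, y)) -> box (\row_k a 0 (lift ord0 k)) r y.
    by move=> ab k; have := ab (lift ord0 k); rewrite !mxE liftK.
  apply: (IHn j (fun y => g (cons_rV (b, y))) _ (\row_k a 0 (lift ord0 k))).
  + move=> y; apply/is_derive_lineP.
    have /is_derive_lineP := dg (cons_rV (b, y)).
    congr (is_derive _ _ _ _); apply/funext => t.
    by rewrite cons_line_tail.
  + move=> y; apply: (@continuous_comp _ _ _ (fun y => cons_rV (b, y)) h).
      exact: continuous_cons_tail.
    exact: ch.
  + by move=> y yb; apply: g0 => /tail.
  + by move=> y yb; apply: h0 => /tail.
- rewrite (integral_tail_head hi); apply: integral0_eq => y _.
  apply: (@integral_derivative0 R (fun b => g (cons_rV (b, y))) _ (a 0 ord0) r).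
  + move=> b; apply/is_derive_lineP.
    have /is_derive_lineP := dg (cons_rV (b, y)).
    congr (is_derive _ _ _ _); apply/funext => t.
    by rewrite -cons_line_head [t *: _]mulr1.
  + move=> b; apply: (@continuous_comp _ _ _ (fun b => cons_rV (b, y)) h).
      exact: continuous_cons_head.
    exact: ch.
  + move=> b rb; have out : ~ box a r (cons_rV (b, y)).
      move=> /(_ ord0); rewrite mxE unlift_none /=.
      by move=> /(lt_le_trans rb); rewrite ltxx.
    by split; [exact: g0|exact: h0].
Qed.

(** * Interior of convex sets *)

Section integral_subnull.
Import HBNNSimple.

(** [D] need not be measurable, so this goes back to the definition of the
    integral as a supremum over simple functions: those below a function that
    vanishes outside [N] have zero integral. It thus covers convex sets, which
    are not all Borel. *)
Lemma integral_subnull (d : measure_display) (T : measurableType d)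
    (R : realType)
    (mu : {measure set T -> \bar R}) (N D : set T) (f : T -> \bar R) :
  measurable N -> mu N = 0%E -> D `<=` N -> (\int[mu]_(x in D) f x = 0)%E.
Proof.
move=> mN N0 DN; suff ge0 (g : T -> \bar R) : (forall x, 0 <= g x)%E ->
  (\int[mu]_(x in D) g x = 0)%E.
  by rewrite integralE !ge0 ?sube0.
move=> g0; apply/eqP; rewrite eq_le integral_ge0 // andbT.
rewrite ge0_integralE //; apply: ge_ereal_sup => _ [h /= hg <-].
rewrite -integralT_nnsfun.
have -> : (\int[mu]_x (h x)%:E = \int[mu]_(x in N) (h x)%:E)%E.
  rewrite [RHS]integral_mkcond; apply: eq_integral => x _; rewrite patchE.
  case: ifPn => // /negP; rewrite in_setE => Nx; have := hg x;
    rewrite patchE ifF.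
    by rewrite lee_fin => hx; congr EFin; apply/eqP; rewrite eq_le hx;
      exact: fun_ge0.
  by apply/negP; rewrite in_setE => /DN.
by rewrite null_set_integral //; apply/measurable_EFinP;
  exact: measurable_funTS.
Qed.

End integral_subnull.

Lemma continuous_lin (R : realType) n (v : 'I_n -> R) :
  continuous (fun x : 'rV[R]_n => \sum_i x 0 i * v i).
Proof.
move=> x; apply: differentiable_continuous.
rewrite (_ : (fun _ => _) = \sum_i (fun x : 'rV[R]_n => x 0 i * v i));
  last first.
  by apply/funext => y; rewrite fct_sumE.
apply: differentiable_sum => i.
by apply: differentiableM;
  [exact: differentiable_coord|exact: differentiable_cst].
Qed.

Lemma measurable_hyperplane (R : realType) n (v : 'I_n -> R) (c : R) :
  measurable [set x : 'rV[R]_n | \sum_i x 0 i * v i = c].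
Proof.
rewrite (_ : [set x | _] =
  (fun x : 'rV[R]_n => \sum_i x 0 i * v i) @^-1` [set c]) //.
rewrite -[X in measurable X]setTI; apply: continuous_measurable_rV => //.
exact: continuous_lin.
Qed.

(** Slicing by the head coordinate: either the slices are hyperplanes in one
    dimension less, or the hyperplane is a product with a single point. *)
Lemma hyperplane_null (R : realType) n (v : 'I_n -> R) (c : R) :
    (exists i, v i != 0) ->
  lebesgue_rV R n [set x : 'rV[R]_n | \sum_i x 0 i * v i = c] = 0%E.
Proof.
elim: n v c => [|n IHn] v c; first by case=> -[].
move=> [i vi]; set H := [set x | _].
have -> : lebesgue_rV R n.+1 H =
  (@lebesgue_measure R \x lebesgue_rV R n)%E (@cons_rV R n @^-1` H) by [].
have HE : @cons_rV R n @^-1` H =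
  [set p : measurableTypeR R * 'rV[R]_n |
  p.1 * v ord0 + \sum_j p.2 0 j * v (lift ord0 j) = c].
  have sE (b : measurableTypeR R) y : \sum_i cons_rV (b, y) 0 i * v i =
      b * v ord0 + \sum_j y 0 j * v (lift ord0 j).
    rewrite big_ord_recl mxE unlift_none; congr (_ + _).
    by apply: eq_bigr => j _; rewrite mxE liftK.
  by apply/seteqP; split => -[b y]; rewrite /H /= sE.
have [/existsP[j vj]|/existsPn v0] := boolP [exists j, v (lift ord0 j) != 0].
  rewrite /product_measure1; apply: integral0_eq => b _ /=.
  rewrite HE (_ : xsection _ b =
    [set y : 'rV[R]_n | \sum_j y 0 j * v (lift ord0 j) = c - b * v ord0]).
    by apply: IHn; exists j.
  apply/seteqP; split => y; rewrite /xsection /= inE /=.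
    by move=> <-; rewrite addrC addKr.
  by move=> ->; rewrite addrC subrK.
have {v0}v0 j : v (lift ord0 j) = 0 by apply/eqP; rewrite -[_ == _]negbK v0.
have v00 : v ord0 != 0 by move: vi; case: (unliftP ord0 i) => [j|] -> //;
  rewrite v0 eqxx.
rewrite HE (_ : [set p | _] = [set c / v ord0] `*` setT).
  rewrite product_measure1E //.
  by rewrite [X in (X * _)%E](lebesgue_measure_set1 (c / v ord0 : R)) mul0e.
apply/seteqP; split => -[b y] /=; rewrite big1 ?addr0 ; try by move=> j _;
  rewrite v0 mulr0.
  by move=> <-; rewrite mulfK.
by move=> [-> _]; rewrite divfK.
Qed.

Section convex_interior.
Context (R : realType) (n : nat) (Om : set 'rV[R]_n).
Hypothesis Om_convex : convex_set (Om : set (convex_lmodType 'rV[R]_n)).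
Implicit Types (x y a : 'rV[R]_n) (l r : R).

Lemma convex_comb x y l : 0 <= l -> l <= 1 -> Om x -> Om y ->
  Om (l *: x + (1 - l) *: y).
Proof.
move=> l0 l1 Ox Oy.
have := Om_convex (Itv01 l0 l1) (mem_set Ox) (mem_set Oy).
by rewrite in_setE.
Qed.

(** Peeling off one vertex at a time, after rescaling the remaining weights. *)
Lemma convex_simplex k x0 (A : 'M[R]_(k, n)) (c : 'rV[R]_k) : Om x0 ->
  (forall i, Om (x0 + row i A)) -> (forall i, 0 <= c 0 i) ->
    \sum_i c 0 i <= 1 ->
  Om (x0 + c *m A).
Proof.
move=> O0; elim: k A c => [|k IHk] A c OA c0 c1.
  by rewrite (thinmx0 c) mul0mx addr0.
pose c' := \row_i c 0 (lift ord0 i); pose A' := \matrix_i row (lift ord0 i) A.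
have cA : c *m A = c 0 ord0 *: row ord0 A + c' *m A'.
  apply/rowP => j; rewrite !mxE big_ord_recl; congr (_ + _).
  by apply: eq_bigr => i _; rewrite !mxE.
have := c1; rewrite big_ord_recl => c1'.
have c'0 : 0 <= \sum_i c' 0 i by apply: sumr_ge0 => i _; rewrite mxE.
have c's : \sum_i c' 0 i = \sum_(i < k) c 0 (lift ord0 i)
  by apply: eq_bigr => i _; rewrite mxE.
have [e|ne] := eqVneq (c 0 ord0) 1.
  have z : forall i, c' 0 i = 0.
    have : \sum_i c' 0 i = 0 by apply/eqP; rewrite eq_le c'0 andbT c's;
      move: c1'; rewrite e; lra.
    move/eqP; rewrite psumr_eq0 => [/allP z i|i _]; last by rewrite mxE.
    by apply/eqP; apply: z; rewrite mem_index_enum.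
  have -> : x0 + c *m A = x0 + row ord0 A.
    rewrite cA e scale1r (_ : c' = 0) ?mul0mx ?addr0 //.
    by apply/rowP => i; rewrite z mxE.
  exact: OA.
have lt1 : c 0 ord0 < 1 by rewrite lt_neqAle ne /=; apply: le_trans c1';
  rewrite lerDl -c's.
have d0 : 0 < 1 - c 0 ord0 by rewrite subr_gt0.
have -> : x0 + c *m A = c 0 ord0 *: (x0 + row ord0 A) +
    (1 - c 0 ord0) *: (x0 + ((1 - c 0 ord0)^-1 *: c') *m A').
  rewrite cA !scalerDr -scalemxAl scalerA mulfV ?gt_eqF // scale1r addrACA
    -scalerDl.
  by rewrite [c 0 ord0 + _]addrC subrK scale1r.
apply: convex_comb => //; first exact: ltW.
apply: IHk => [i|i|].
- by rewrite rowK; exact: OA.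
- by rewrite !mxE mulr_ge0 // invr_ge0 ltW.
- under eq_bigr do rewrite mxE;
  rewrite -mulr_sumr mulrC ler_pdivrMr // mul1r c's; lra.
Qed.

(** A greedy choice: as long as the directions chosen so far do not span, some
    covector annihilates them, and the separation hypothesis supplies a further
    independent direction. *)
Lemma convex_free k x0 : Om x0 ->
  (forall v : 'cV[R]_n, v != 0 -> exists2 x, Om x & (x - x0) *m v != 0) ->
  (k <= n)%N ->
  exists2 A : 'M[R]_(k, n), row_free A & forall i, Om (x0 + row i A).
Proof.
move=> O0 sep; elim: k => [|k IHk] kn.
  exists 0 => [|[]//]; by rewrite /row_free mxrank0.
have [A fA OA] := IHk (ltnW kn).
have : kermx A^T != 0.
  by rewrite -mxrank_eq0 mxrank_ker mxrank_tr (eqP fA) -lt0n subn_gt0.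
rewrite -nz_row_eq0; set w := nz_row _ => w0.
have Aw : A *m w^T = 0.
  have /sub_kermxP : (w <= kermx A^T)%MS by exact: nz_row_sub.
  by move=> /(congr1 trmx); rewrite trmx_mul trmxK trmx0.
have [|x Ox xw] := sep w^T; first by rewrite trmx_eq0.
have fB : row_free (col_mx (x - x0) A).
  apply: inj_row_free => u; rewrite -[u]hsubmxK mul_row_col => e.
  have := congr1 (fun B => B *m w^T) e.
  rewrite mulmxDl -!mulmxA Aw mulmx0 addr0 mul0mx.
  rewrite [(x - x0) *m _]mx11_scalar mul_mx_scalar => /eqP; rewrite scaler_eq0.
  case/orP => [/eqP z|/eqP z].
    by move: xw; rewrite [(x - x0) *m _]mx11_scalar z -scalemx1 scale0r eqxx.
  move: e; rewrite z mul0mx add0r => /eqP; rewrite mulmx_free_eq0 // => /eqP ->.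
  by rewrite row_mx0.
have OB (i : 'I_(1 + k)) : Om (x0 + row i (col_mx (x - x0) A)).
  case: (split_ordP i) => j ->; last by rewrite rowKd.
  by rewrite rowKu row_id addrC subrK.
by exists (col_mx (x - x0) A).
Qed.

(** In the coordinates given by [A], the set contains the standard simplex,
    which has an interior point with all coordinates equal. *)
Lemma convex_box_free x0 (A : 'M[R]_n) : Om x0 -> row_free A ->
    (forall i, Om (x0 + row i A)) ->
  exists a r, 0 < r /\ box a r `<=` Om.
Proof.
move=> O0; rewrite row_free_unit => uA OA.
(* the box of radius [t] around [(t, ..., t)] has nonnegative coordinates of sum
   at most [2 t n <= 1] *)
pose t : R := (n.+1.*2)%:R^-1.
have t0 : 0 < t by rewrite invr_gt0 ltr0n.
pose c : 'rV[R]_n := const_mx t.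
pose f x := (x - x0) *m invmx A.
have cf : continuous f.
  apply: continuous_rV => j; rewrite (_ : (fun _ => _) =
      (fun x : 'rV[R]_n => \sum_i x 0 i * invmx A i j) - cst
        ((x0 *m invmx A) 0 j)).
    by move=> x; apply: continuousB;
      [exact: continuous_lin|exact: cst_continuous].
  by apply/funext => x; rewrite /f mulmxBl mxE mxE [LHS]addrC !fctE mxE addrC.
have fa : f (x0 + c *m A) = c by rewrite /f addrAC subrr add0r mulmxK.
have /nbhs_box[r r0 rB] : nbhs (x0 + c *m A) (f @^-1` cube c t).
  by apply: cf; rewrite fa; exact: nbhs_cube.
exists (x0 + c *m A), r; split => // x /rB /= xc.
have -> : x = x0 + f x *m A by rewrite /f mulmxKV // addrC subrK.
have xb i : 0 <= f x 0 i <= t *+ 2.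
  have := xc i; rewrite [c 0 i]mxE mulr2n ltr_norml => /andP[? ?]; apply/andP;
    split; lra.
apply: convex_simplex => // [i|]; first by case/andP: (xb i).
apply: (@le_trans _ _ (\sum_(i < n) t *+ 2)).
  by apply: ler_sum => i _; case/andP: (xb i).
rewrite sumr_const card_ord -mulrnA /t -[_ *+ _]mulr_natr mulrC ler_pdivrMr
  ?ltr0n // mul1r.
by rewrite ler_nat -mul2n leq_mul2l /= leqnSn.
Qed.

(** A convex set that contains no box lies in a hyperplane, which is null, so
    every integral over it vanishes. Applied to a probability density, this
    produces interior points. *)
Lemma convex_box (f : 'rV[R]_n -> R) :
    \int[lebesgue_rV R n]_(x in Om) f x != 0 ->
  exists a r, 0 < r /\ box a r `<=` Om.
Proof.
move=> f0.
have null N : measurable N -> lebesgue_rV R n N = 0%E -> ~ (Om `<=` N).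
  by move=> mN N0 ON; move: f0;
    rewrite /Rintegral (integral_subnull _ mN N0 ON) eqxx.
have [x0 O0] : exists x0, Om x0.
  apply/not_existsP => O0; apply: (null set0);
    [exact: measurable0|exact: measure0|].
  by move=> x /O0.
have [|A fA OA] := @convex_free n x0 O0 _ (leqnn n);
  last exact: convex_box_free OA.
move=> v v0; apply: contrapT => nsep.
have vi : exists i, v i 0 != 0.
  by move: v0; apply: contra_neqP => /forallNP vi; apply/colP => i;
    rewrite mxE; have /negP := vi i; rewrite negbK => /eqP.
apply: (null [set x : 'rV[R]_n | \sum_i x 0 i * v i 0 = (x0 *m v) 0 0]).
- exact: measurable_hyperplane.
- exact: hyperplane_null.
- move=> x Ox; have : (x - x0) *m v = 0.
    by apply/eqP; apply: contrapT => /negP xv; apply: nsep; exists x.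
  by rewrite mulmxBl => /subr0_eq <-; rewrite mxE.
Qed.

(** The cone over a box with apex [x] stays inside the convex set. *)
Lemma convex_shrink a r x l : box a r `<=` Om -> Om x -> 0 < l -> l <= 1 ->
  box (l *: a + (1 - l) *: x) (l * r) `<=` Om.
Proof.
move=> aO Ox l0 l1 y yb; have ln : l != 0 by rewrite gt_eqF.
pose z := l^-1 *: (y - (1 - l) *: x).
have -> : y = l *: z + (1 - l) *: x
  by rewrite /z scalerA mulfV // scale1r subrK.
apply: convex_comb => //; [exact: ltW|apply: aO => i].
have := yb i; rewrite !mxE.
have -> : y 0 i - (l * a 0 i + (1 - l) * x 0 i) =
  l * (l^-1 * (y 0 i - (1 - l) * x 0 i) - a 0 i).
  by field.
by rewrite normrM gtr0_norm // ler_pM2l.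
Qed.

(** The interior is dense in the set, because shrinking a box towards [x] gives
    boxes of the set with centres arbitrarily close to [x]. *)
Lemma convex_interior_dense (q : 'rV[R]_n -> R) x a r : 0 < r ->
    box a r `<=` Om ->
  (forall b s, 0 < s -> box b s `<=` Om -> q b = 0) -> Om x ->
    {for x, continuous q} -> q x = 0.
Proof.
move=> r0 aO q0 Ox cq; apply: contrapT => /eqP qx.
have /nbhs_box[s s0 sq] : nbhs x (q @^-1` [set y | y != 0]).
  by apply: cq; apply: open_nbhs_nbhs; split => //; exact: open_neq.
pose S := \sum_i `|a 0 i - x 0 i|.
have S0 : 0 <= S by apply: sumr_ge0.
(* [l * S <= s] keeps the entries of [l * (a - x)] within [s] *)
pose l := s / (s + S).
have sS : 0 < s + S by rewrite ltr_wpDr.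
have l0 : 0 < l by rewrite divr_gt0.
have l1 : l <= 1 by rewrite ler_pdivrMr // mul1r lerDl.
have := q0 _ _ (mulr_gt0 l0 r0) (convex_shrink aO Ox l0 l1).
apply/eqP; apply: sq => i; rewrite !mxE.
have -> : l * a 0 i + (1 - l) * x 0 i - x 0 i = l * (a 0 i - x 0 i) by ring.
rewrite normrM gtr0_norm // /l mulrAC ler_pdivrMr // ler_pM2l //.
apply: (@le_trans _ _ S); last by rewrite lerDr ltW.
by rewrite /S (bigD1 i) //= lerDl sumr_ge0.
Qed.

End convex_interior.

(** * Test functions on Omega *)

Section compact_support.
Context (R : realType) (d : nat).
Local Notation mu := (lebesgue_rV R d).
Implicit Types (a : 'rV[R]_d) (r : R) (Om U : set 'rV[R]_d)
    (f u v : 'rV[R]_d -> R).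

Lemma supported_partial a r f i : supported a r f -> supported a r
    (partial i f).
Proof.
move=> f0 x xb; rewrite (@partial_ext _ _ (~` box a r) f (cst 0)) //.
- by rewrite /partial derive_cst.
- exact/closed_openC/closed_box.
Qed.

Lemma smooth_supported a r Om U f : open U -> Om `<=` U -> box a r `<=` Om ->
    smooth U f -> supported a r f -> smooth setT f.
Proof.
move=> oU OU bO sf f0;
  apply: (smooth_extend0 oU (closed_box (a := a) (r := r))) => //.
exact: subset_trans OU.
Qed.

Lemma integral_supported Om a r f : box a r `<=` Om -> supported a r f ->
  (\int[mu]_(x in Om) (f x)%:E = \int[mu]_x (f x)%:E)%E.
Proof.
move=> bO f0; rewrite integral_mkcond; apply: eq_integral => x _;
  rewrite patchE.
by case: ifPn => // /negP; rewrite in_setE => Ox; rewrite f0 // => /bO.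
Qed.

Lemma Rintegral_supported Om a r f : box a r `<=` Om -> supported a r f ->
  \int[mu]_(x in Om) f x = \int[mu]_x f x.
Proof. by move=> bO f0; rewrite /Rintegral (integral_supported bO f0). Qed.

Lemma integrable_supported Om a r f : continuous f -> box a r `<=` Om ->
    supported a r f ->
  mu.-integrable Om (EFin \o f).
Proof.
move=> cf bO f0; have /integrableP[mf fi] := integrable_compact_support cf f0.
apply/integrableP; split; first exact: measurable_funTS.
have n0 : supported a r (fun x => `|f x|) by move=> x /f0 ->; rewrite normr0.
by have := integral_supported bO n0; rewrite /= => ->.
Qed.

Lemma integral_divergence0 a r (X : 'I_d -> 'rV[R]_d -> R) :
  (forall i, smooth setT (X i)) -> (forall i, supported a r (X i)) ->
  \int[mu]_x (\sum_i partial i (X i) x) = 0.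
Proof.
move=> sX X0; rewrite /Rintegral; under eq_integral do rewrite -sumEFin.
rewrite integral_sum //; last first.
  move=> i; apply: (@integrable_compact_support _ _ a r (partial i (X i))).
    exact/smooth_continuous/smooth_partial.
  exact: supported_partial.
rewrite big1 // => i _; apply: (@integral_partial0 _ _ i (X i) _ a r).
- by move=> x; apply: derivableP; apply: diff_derivable;
  exact: (smooth_differentiable (sX i)).
- exact/smooth_continuous/smooth_partial.
- exact: X0.
- exact: supported_partial.
Qed.

(** The fundamental lemma of the calculus of variations, tested against a bump
    multiplied by [q a] so that the integrand is nonnegative whatever the sign
    of [q a]. *)
Lemma vanish_on_box Om U q a r : open U -> Om `<=` U -> smooth U q -> 0 < r ->
    box a r `<=` Om ->
  (forall s theta, box a s `<=` Om -> smooth setT theta ->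
    supported a s theta -> \int[mu]_(x in Om) (theta x * q x) = 0) ->
  q a = 0.
Proof.
move=> oU OU sq r0 bO q0; apply: contrapT => /eqP qa.
have Oa : Om a by apply: bO => i; rewrite subrr normr0 ltW.
have cq : {for a, continuous q} by apply: differentiable_continuous;
  exact: (smooth_differentiable sq (OU _ Oa)).
have [s s0 sP] : exists2 s, 0 < s & box a s `<=` [set y | 0 < q a * q y].
  apply: nbhs_box.
  have cqq : {for a, continuous (fun y => q a * q y)}
    by apply: continuousM => //; exact: cst_continuous.
  apply: (cqq [set z | 0 < z]); apply: open_nbhs_nbhs; split;
    first exact: open_gt.
  by rewrite /= -expr2 exprn_even_gt0.
pose m := Num.min r s.
have m0 : 0 < m by rewrite lt_min r0.
have mO : box a m `<=` Om.
  by move=> x xm; apply: bO => i; apply: le_trans (xm i) _; rewrite ge_min lexx.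
have mP x : box a m x -> 0 < q a * q x.
  by move=> xm; apply: sP => i; apply: le_trans (xm i) _;
    rewrite ge_min lexx orbT.
pose theta := cst (q a) \* box_bump a m.
have th0 : supported a m theta by move=> x xb;
  rewrite /theta /= supported_box_bump // mulr0.
have sth : smooth setT theta by apply: smoothM;
  [exact: openT|exact: smooth_cst|exact: smooth_box_bump].
pose w x := theta x * q x.
have w0 : supported a m w by move=> x xb; rewrite /w th0 // mul0r.
have wE x : w x = box_bump a m x * (q a * q x) by rewrite /w /theta /=; ring.
have sw : smooth setT w.
  apply: (smooth_supported oU OU mO) => //; apply: smoothM => //;
    exact: smoothS sth.
have wge x : 0 <= w x.
  have [xb|/w0 ->//] := pselect (box a m x).
  by rewrite wE mulr_ge0 ?box_bump_ge0 // ltW // mP.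
have wi := integrable_compact_support (smooth_continuous sw) w0.
have iw : (\int[mu]_x (w x)%:E = 0)%E.
  have := q0 m theta mO sth th0;
    rewrite (Rintegral_supported mO w0) /Rintegral => e.
  by rewrite -[LHS]fineK ?e //; exact: integrable_fin_num wi.
have : (\int[mu]_x `|(EFin \o w) x| = 0)%E.
  by rewrite -[RHS]iw; apply: eq_integral => x _; rewrite gee0_abs // lee_fin.
move=> /(ae_eq_integral_abs mu measurableT (measurable_int _ wi))[A [mA A0 wA]].
have := lebesgue_cube_gt0 a m0.
have : (mu (cube a m) <= mu A)%E.
  rewrite le_measure ?inE //; first exact: measurable_cube.
  move=> x xm; apply: wA => /(_ I) /= [] wx.
  have : 0 < w x by rewrite wE mulr_gt0 ?box_bump_gt0 ?mP // => i;
    exact: ltW (xm i).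
  by rewrite wx ltxx.
by rewrite A0 => /le_lt_trans h /h; rewrite ltxx.
Qed.

End compact_support.

(** * The Onsager operator *)

Section onsager.
Context (R : realType) (d : nat) (Om : set 'rV[R]_d) (rho : 'rV[R]_d -> R).
Local Notation mu := (lebesgue_rV R d).
Local Notation C := (covariance_mx Om rho).
Implicit Types (a : 'rV[R]_d) (r : R) (U : set 'rV[R]_d) (u v : 'rV[R]_d -> R).

Definition flux v i y := (rho y *: (C *m grad v y)) i 0.

Lemma fluxE v i y : flux v i y = rho y * \sum_j C i j * partial j v y.
Proof.
by rewrite /flux [LHS]mxE [X in _ * X]mxE; congr (_ * _);
  apply: eq_bigr => j _; rewrite [grad v y j 0]mxE.
Qed.

Lemma onsagerE v x : onsager Om rho v x = - \sum_i partial i (flux v i) x.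
Proof. by []. Qed.

Lemma kw_formE u v x : kw_form Om rho u v x = \sum_i partial i u x * flux v i x.
Proof.
rewrite /kw_form /dot mulr_suml; apply: eq_bigr => i _.
by rewrite /flux [grad u x i 0]mxE [X in _ = _ * X]mxE; ring.
Qed.

Lemma covariance_mx_sym i j : C i j = C j i.
Proof. by rewrite !mxE; apply: eq_Rintegral => x _; congr (_ * _);
  rewrite mulrC. Qed.

Lemma kw_form_sym u v x : kw_form Om rho u v x = kw_form Om rho v u x.
Proof.
rewrite !kw_formE.
have expand u1 v1 : \sum_i partial i u1 x * flux v1 i x =
    \sum_i \sum_j partial i u1 x * (rho x * (C i j * partial j v1 x)).
  by apply: eq_bigr => i _; rewrite fluxE !mulr_sumr.
rewrite !expand exchange_big; apply: eq_bigr => i _; apply: eq_bigr => j _.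
by rewrite (covariance_mx_sym j i); ring.
Qed.

Lemma smooth_flux U v i : open U -> smooth U rho -> smooth U v -> smooth U
    (flux v i).
Proof.
move=> oU sr sv; rewrite (_ : flux v i =
  fun y => rho y * \sum_j C i j * partial j v y).
  apply: smoothM => //; apply: smooth_sum => // j.
  by apply: smoothM => //; [exact: smooth_cst|exact: smooth_partial].
by apply/funext => y; exact: fluxE.
Qed.

Lemma smooth_onsager U v : open U -> smooth U rho -> smooth U v -> smooth U
    (onsager Om rho v).
Proof.
move=> oU sr sv; apply: smoothN => //; apply: smooth_sum => // i.
by apply: smooth_partial; exact: smooth_flux.
Qed.

Lemma smooth_kw_form U u v : open U -> smooth U rho -> smooth U u ->
    smooth U v -> smooth U (kw_form Om rho u v).
Proof.
move=> oU sr su sv; rewrite (_ : kw_form Om rho u v =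
  fun x => \sum_i partial i u x * flux v i x).
  by apply: smooth_sum => // i; apply: smoothM => //;
    [exact: smooth_partial|exact: smooth_flux].
by apply/funext => x; exact: kw_formE.
Qed.

Lemma supported_flux a r v i : supported a r v -> supported a r (flux v i).
Proof.
move=> v0 x xb; rewrite fluxE big1 ?mulr0 // => j _.
by rewrite (supported_partial _ v0) // mulr0.
Qed.

Lemma supported_onsager a r v : supported a r v -> supported a r
    (onsager Om rho v).
Proof.
move=> v0 x xb; rewrite onsagerE big1 ?oppr0 // => i _.
by apply: (supported_partial i _ xb); exact: supported_flux.
Qed.

Lemma supported_kw_forml a r u v : supported a r u -> supported a r
    (kw_form Om rho u v).
Proof.
move=> u0 x xb; rewrite kw_formE big1 // => i _.
by rewrite (supported_partial _ u0) // mul0r.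
Qed.

Lemma supported_kw_formr a r u v : supported a r v -> supported a r
    (kw_form Om rho u v).
Proof. by move=> v0 x xb; rewrite kw_form_sym;
  exact: (supported_kw_forml _ v0). Qed.

Lemma divergence_flux U u v x : open U -> smooth U rho -> smooth U u ->
    smooth U v -> U x ->
  \sum_i partial i (u \* flux v i) x =
    kw_form Om rho u v x - u x * onsager Om rho v x.
Proof.
move=> oU sr su sv Ux;
  rewrite onsagerE kw_formE mulrN opprK mulr_sumr -big_split /=.
apply: eq_bigr => i _; have fx :=
  smooth_differentiable (smooth_flux i oU sr sv) Ux.
by rewrite (partialM i (smooth_differentiable su Ux) fx) [LHS]addrC;
  congr (_ + _); exact: mulrC.
Qed.

(** The weak form of the Onsager operator. The difference of the two
    integrands is the divergence of [u * flux v], and a support condition on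
    one of the two functions makes this field globally smooth with compact
    support, whatever [Om] looks like near its boundary. *)
Lemma green U a r u v : open U -> Om `<=` U -> box a r `<=` Om ->
  smooth U rho -> smooth U u -> smooth U v ->
    supported a r u \/ supported a r v ->
  \int[mu]_(x in Om) (u x * onsager Om rho v x) =
    \int[mu]_(x in Om) kw_form Om rho u v x.
Proof.
move=> oU OU bO sr su sv uv0.
pose f1 x := u x * onsager Om rho v x; pose f2 := kw_form Om rho u v.
have f10 : supported a r f1.
  move=> x xb; rewrite /f1; case: uv0 => w0; first by rewrite w0 // mul0r.
  by rewrite (supported_onsager w0) // mulr0.
have f20 : supported a r f2 by case: uv0 => w0;
  [exact: supported_kw_forml|exact: supported_kw_formr].
have X0 i : supported a r (u \* flux v i).
  move=> x xb /=; case: uv0 => w0; first by rewrite w0 // mul0r.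
  by rewrite (supported_flux _ w0) // mulr0.
have sf1 : smooth setT f1.
  by apply: (smooth_supported oU OU bO) => //; apply: smoothM => //;
    exact: smooth_onsager.
have sf2 : smooth setT f2 by apply: (smooth_supported oU OU bO) => //;
  exact: smooth_kw_form.
have sX i : smooth setT (u \* flux v i).
  by apply: (smooth_supported oU OU bO) => //; apply: smoothM => //;
    exact: smooth_flux.
rewrite -/f2 (Rintegral_supported bO f10) (Rintegral_supported bO f20).
apply/esym/subr0_eq; rewrite -RintegralB //; last 2 first.
- exact: integrable_compact_support (smooth_continuous sf2) f20.
- exact: integrable_compact_support (smooth_continuous sf1) f10.
rewrite -[RHS](integral_divergence0 sX X0); apply: eq_Rintegral => x _.
have [xb|xb] := pselect (box a r x).
  by rewrite (divergence_flux oU) //; exact/OU/bO.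
rewrite f10 // f20 // subrr big1 // => i _; exact: (supported_partial _ (X0 i)).
Qed.

(** Compactly supported functions satisfy the no-flux condition automatically;
    they are the directions in which the gradient identity can be tested.
    That [onsager theta] has zero mean is Green's identity against the
    constant [1]. *)
Lemma test_cotangent a r theta : smooth_on Om rho -> box a r `<=` Om ->
  smooth setT theta -> supported a r theta -> cotangent Om rho theta.
Proof.
move=> [U oU [OU sr]] bO sth th0.
have sthU : smooth U theta by exact: smoothS sth.
have sons : smooth U (onsager Om rho theta) by exact: smooth_onsager.
have ons0 := supported_onsager th0.
split.
- by exists setT; [exact: openT|split].
- apply: (integrable_supported _ bO (supported_kw_forml _ th0));
  apply: smooth_continuous.
  by apply: (smooth_supported oU OU bO (smooth_kw_form _ _ _ _)) => //;
    exact: supported_kw_forml.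
- split; first by exists U.
    apply: (integrable_supported _ bO ons0); apply: smooth_continuous.
    exact: (smooth_supported oU OU bO).
  have := @green U a r (cst 1) theta oU OU bO sr (@smooth_cst _ _ _ _) sthU
    (or_intror th0).
  under eq_Rintegral do rewrite mul1r.
  move=> ->; transitivity (\int[mu]_(x in Om) (0 : R)).
    apply: eq_Rintegral => x _; rewrite kw_formE big1 // => i _.
    by rewrite /partial derive_cst mul0r.
  by rewrite /Rintegral integral0.
- move=> eta [V oV [OV seta]] _ _.
  have oUV : open (U `&` V) by exact: openI.
  apply: (green oUV (a := a) (r := r)) => //; last by right.
  + by move=> x Ox; split; [exact: OU|exact: OV].
  + by apply: smoothS sr => x [].
  + by apply: smoothS seta => x [].
  + exact: smoothS sth.
Qed.

(** Testing the identity that defines the gradient on the tangent vector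
    [onsager theta], and integrating by parts on both sides, shows that [G] and
    [onsager psi] have the same integral against every test function [theta]. *)
Lemma kw_gradient_onsager psi G : convex_set
    (Om : set (convex_lmodType 'rV[R]_d)) ->
  smooth_density Om rho -> smooth_on Om psi -> kw_gradient Om rho psi G ->
  forall x, Om x -> G x = onsager Om rho psi x.
Proof.
move=> cO [[_ _ rho1] _ srho] spsi [[phi [phiC phiG]] tG Ggrad].
have [U [oU OU sr sp sG]] :
  exists U, [/\ open U, Om `<=` U, smooth U rho, smooth U psi & smooth U G].
  have [U1 oU1 [OU1 s1]] := srho; have [U2 oU2 [OU2 s2]] := spsi.
  have [[U3 oU3 [OU3 s3]] _ _] := tG.
  exists (U1 `&` U2 `&` U3); split.
  - by apply: openI => //; exact: openI.
  - by move=> x Ox; split; [split|]; [exact: OU1|exact: OU2|exact: OU3].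
  - by apply: smoothS s1 => x [[]].
  - by apply: smoothS s2 => x [[]].
  - by apply: smoothS s3 => x [].
pose q x := G x - onsager Om rho psi x.
have sq : smooth U q.
  by apply: (smoothD oU sG); apply: smoothN => //; exact: smooth_onsager.
have key a r theta : box a r `<=` Om -> smooth setT theta ->
  supported a r theta ->
    \int[mu]_(x in Om) (theta x * q x) = 0.
  move=> bO sth th0.
  have sthU : smooth U theta by exact: smoothS sth.
  have thC := test_cotangent srho bO sth th0.
  have [_ _ thT _] := thC; have [_ kwi _ _] := thC.
  have [M thM] := bounded_compact_support (smooth_continuous sth) th0.
  have off1 : supported a r (fun x => theta x * G x) by move=> x xb;
    rewrite th0 // mul0r.
  have off2 : supported a r (fun x => theta x * onsager Om rho psi x)
    by move=> x xb; rewrite th0 // mul0r.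
  (* the no-flux convention on the potential [phi] of [G] *)
  have e1 : \int[mu]_(x in Om) (theta x * G x) =
    \int[mu]_(x in Om) kw_form Om rho theta phi x.
    have [_ _ _ ibp] := phiC; rewrite -ibp //.
    - by apply: eq_Rintegral => x; rewrite inE => Ox; rewrite phiG.
    - by exists setT; [exact: openT|split].
    - by exists M.
  (* the defining property of the gradient, in the direction [onsager theta] *)
  have e2 : \int[mu]_(x in Om) kw_form Om rho theta phi x =
      \int[mu]_(x in Om) (psi x * onsager Om rho theta x).
    apply: Ggrad thT _ _; last by exists theta, phi.
    have o0 : supported a r (fun x => psi x * onsager Om rho theta x).
      by move=> x xb; rewrite (supported_onsager th0) // mulr0.
    apply: (integrable_supported _ bO o0); apply: smooth_continuous.
    exact: (smooth_supported oU OU bO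
      (smoothM oU sp (smooth_onsager oU sr sthU)) o0).
  (* symmetry of the Onsager operator, from that of the covariance matrix *)
  have e3 : \int[mu]_(x in Om) (psi x * onsager Om rho theta x) =
      \int[mu]_(x in Om) (theta x * onsager Om rho psi x).
    apply: (eq_trans (green oU OU bO sr sp sthU (or_intror th0))).
    apply: (eq_trans _ (esym (green oU OU bO sr sthU sp (or_introl th0)))).
    by apply: eq_Rintegral => x _; exact: kw_form_sym.
  have off3 : supported a r (fun x => theta x * q x) by move=> x /th0 z;
    rewrite z mul0r.
  have i1 : mu.-integrable setT (EFin \o (fun x => theta x * G x)).
    apply: (integrable_compact_support (smooth_continuous _) off1).
    exact: (smooth_supported oU OU bO (smoothM oU sthU sG) off1).
  have i2 : mu.-integrable setT
    (EFin \o (fun x => theta x * onsager Om rho psi x)).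
    apply: (integrable_compact_support (smooth_continuous _) off2).
    exact: (smooth_supported oU OU bO
      (smoothM oU sthU (smooth_onsager oU sr sp)) off2).
  have e : \int[mu]_x (theta x * G x) =
    \int[mu]_x (theta x * onsager Om rho psi x).
    apply: (eq_trans (esym (Rintegral_supported bO off1))).
    apply: (eq_trans e1); apply: (eq_trans e2); apply: (eq_trans e3).
    exact: Rintegral_supported bO off2.
  apply: (eq_trans (Rintegral_supported bO off3)).
  transitivity (\int[mu]_x (theta x * G x - theta x * onsager Om rho psi x)).
    by apply: eq_Rintegral => x _; exact: mulrBr.
  apply: (eq_trans (RintegralB measurableT i1 i2)).
  exact: (eq_trans (congr1 (fun z => z - _) e) (subrr _)).
have [a [r [r0 bO]]] : exists a r, 0 < r /\ box a r `<=` Om.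
  by apply: (@convex_box _ _ _ cO rho); rewrite rho1 oner_eq0.
move=> x Ox; apply: subr0_eq;
  apply: (@convex_interior_dense _ _ _ cO q x a r) => //.
- by move=> b s s0 bsO; apply: (vanish_on_box oU OU sq s0 bsO) => s';
  exact: key.
- by apply: differentiable_continuous;
  exact: (smooth_differentiable sq (OU _ Ox)).
Qed.

End onsager.

Theorem proposition7 (R : realType) (d : nat) (Omega : set 'rV[R]_d)
    (F : ('rV[R]_d -> R) -> R) (dF : ('rV[R]_d -> R) -> 'rV[R]_d -> R)
    (J : set R) (rho : R -> 'rV[R]_d -> R)
    (Omega_convex : convex_set (Omega : set (convex_lmodType 'rV[R]_d)))
    (rho_mean_covariance : forall t, J t -> has_mean_covariance Omega (rho t))
    (F_variation : forall t, J t ->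
       first_variation Omega F (rho t) (dF (rho t)))
    (rho_flow : kw_gradient_flow Omega J dF rho) :
  forall t x, J t -> Omega x ->
    is_derive t (1 : R) (fun s => rho s x)
      (divergence
         (fun y => rho t y *: (covariance_mx Omega (rho t) *m
                               grad (dF (rho t)) y)) x).
Proof.
move=> t x Jt Ox; have [rho_t [G gradG flow]] := rho_flow t Jt.
have [spsi _] := F_variation t Jt.
apply: (is_derive_eq (flow x Ox)).
by rewrite (kw_gradient_onsager Omega_convex rho_t spsi gradG Ox) /onsager
  opprK.
Qed.
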